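(* Let $a\in\mathbb{R}$ and $b\in\mathbb{C}$. There exists a stable degree one symmetric polynomial $p(z_1,z_2)=p_0+p_1(z_1+z_2)$ in $d=2$ variables such that $$\widehat{\frac{1}{|p|^2}}(0,0)=a,\qquad \widehat{\frac{1}{|p|^2}}(1,0)=b$$ if and only if $|b|<a$. In that case, the polynomial $p(z)=p_0+p_1(z_1+z_2)$ is given via $$\begin{bmatrix} a & \bar b & \bar b\\ b & a & \frac{|b|^2}{a}\\ b & \frac{|b|^2}{a} & a\end{bmatrix}\begin{bmatrix}|p_0|^2\\ p_1\overline{p_0}\\ p_1\overline{p_0}\end{bmatrix}=\begin{bmatrix}1\\0\\0\end{bmatrix}.$$
   Context: A degree one symmetric polynomial in $d$ variables is a polynomial of the form $p(z_1,\ldots,z_d)=p_0+p_1(z_1+\cdots+z_d)$ with $p_0,p_1\in\mathbb{C}$ (the case $p_1=0$ is allowed). It is called stable if it has no roots in the closed polydisk $\{(z_1,\ldots,z_d)\in\mathbb{C}^d: |z_j|\le 1 \text{ for all } j\}$. For a function $f$ on the torus $\mathbb{T}^d=\{z\in\mathbb{C}^d:|z_j|=1\text{ for all }j\}$, $\widehat f(k)$ denotes its $k$th Fourier coefficient, $k\in\mathbb{Z}^d$, i.e. the coefficient of $z^k=z_1^{k_1}\cdots z_d^{k_d}$ in the Fourier series $f(z)=\sum_{k}\widehat f(k)z^k$. *)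

(* Defs.v *)
From HB Require Import structures.
From mathcomp Require Import all_boot all_order all_algebra.
From mathcomp Require Import complex.
From mathcomp Require Import all_classical all_reals all_analysis.

Set Implicit Arguments.
Unset Strict Implicit.
Unset Printing Implicit Defensive.

Import Order.TTheory GRing.Theory Num.Theory.
Import numFieldNormedType.Exports.

Local Open Scope classical_set_scope.
Local Open Scope ring_scope.
Local Open Scope complex_scope.

Definition symm1 (R : realType) (p0 p1 z1 z2 : R[i]) : R[i] :=
  p0 + p1 * (z1 + z2).

Definition stable (R : realType) (p : R[i] -> R[i] -> R[i]) : Prop :=
  forall z1 z2 : R[i], `|z1| <= 1 -> `|z2| <= 1 -> p z1 z2 != 0.

Definition expi (R : realType) (t : R) : R[i] := cos t +i* sin t.

Definition square_integral (R : realType) (g : R * R -> R[i]) : R[i] :=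
  let mu := (@lebesgue_measure R \x @lebesgue_measure R)%E in
  let D := `[0, 2 * pi] `*` `[0, 2 * pi] in
  (\int[mu]_(x in D) complex.Re (g x)) +i*
  (\int[mu]_(x in D) complex.Im (g x)).

(* Fourier coefficient of index (k1, k2) of the restriction of f to the
   torus, with respect to the normalized Lebesgue measure. *)
Definition fourier_coef (R : realType) (f : R[i] -> R[i] -> R[i])
    (k1 k2 : int) : R[i] :=
  (((2 * pi) ^+ 2)^-1)%:C *
  square_integral (fun x : R * R =>
    f (expi x.1) (expi x.2) * expi x.1 ^ (- k1) * expi x.2 ^ (- k2)).

Definition inv_sqr_norm (R : realType) (p : R[i] -> R[i] -> R[i])
    (z1 z2 : R[i]) : R[i] :=
  (`|p z1 z2| ^+ 2)^-1.

Definition moment_matrix (R : realType) (a : R) (b : R[i]) : 'M[R[i]]_3 :=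
  let A := a%:C in
  let c := `|b| ^+ 2 / A in
  \matrix_(i, j) nth 0 (nth [::]
    [:: [:: A; b^*; b^*];
        [:: b; A;   c  ];
        [:: b; c;   A  ]] i) j.

Definition coef_vector (R : realType) (p0 p1 : R[i]) : 'cV[R[i]]_3 :=
  \col_i nth 0 [:: `|p0| ^+ 2; p1 * p0^*; p1 * p0^*] i.

(* Main.v *)
Require Import Defs.
From HB Require Import structures.
From mathcomp Require Import all_boot all_order all_algebra.
From mathcomp Require Import complex ring lra.
From mathcomp Require Import all_classical all_reals all_analysis.
From mathcomp Require Import measurable_realfun.

Import Order.TTheory GRing.Theory Num.Theory.
Import numFieldNormedType.Exports.

Local Open Scope classical_set_scope.
Local Open Scope ring_scope.
Local Open Scope complex_scope.

(** A stable p = p0 + p1 (z1 + z2) is encoded by a stable polynomial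
    q(z) = g + d z in one variable, with g > 0 and |d| < g, through
      |p0|^2 = g^2 + |d|^2   and   p1 conj(p0) = g d,
    that is, |p0|^2 + 2 Re (p1 conj(p0) z) = |q(z)|^2 on the unit circle.
    Stability of p means 2 |p1| < |p0|, which is exactly the solvability of
    this spectral factorization ([stable_factor_pair], [factor_pair_stable]).

    For fixed z1 on the circle, 1 / |p(z1, .)|^2 is a multiple of a Poisson
    kernel; its mean in z2 is the inverse of
      |p0 + p1 z1|^2 - |p1|^2 = |q(z1)|^2.
    So the Fourier coefficients of 1 / |p|^2 of index (k, 0) are those of
    1 / |q|^2, again a multiple of a Poisson kernel, and
      a = 1 / (g^2 - |d|^2),   b = - (d / g) a
    ([fourier_coef00], [fourier_coef10]).  The map (g, d) |-> (a, b) is a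
    bijection from the pairs with |d| < g onto those with |b| < a, its inverse
    being g^2 = a / (a^2 - |b|^2), d = - b g / a ([moments_factor_pair]).  In
    terms of (g, d) the linear system for |p0|^2 and p1 conj(p0) has the unique
    solution g^2 + |d|^2, g d ([factor_pair_moments], [moment_eq_factor_pair]),
    which gives all the implications.

    The one-variable integrals are computed from explicit primitives: with
    q(e^(it)) = N + i M, one has N > 0, and (t - 2 atan (M / N)) / (g^2 - |d|^2)
    is a primitive of 1 / |q|^2. *)

(** * Integrals of Poisson kernels *)

Lemma Rintegral_period {R : realType} (f F : R -> R) :
  continuous f -> (forall t, is_derive (t : R) (1 : R) F (f t)) ->
  \int[@lebesgue_measure R]_(t in `[0, 2 * pi]) f t = F (2 * pi) - F 0.
Proof.
move=> cf dF.
have cF : continuous F.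
  by move=> t; apply/differentiable_continuous/derivable1_diffP; case: (dF t).
rewrite /Rintegral (@continuous_FTC2 _ f F) //.
- by rewrite mulr_gt0 ?pi_gt0.
- exact: continuous_subspaceT.
- split; first by move=> t _; case: (dF t).
  + exact/cvg_at_right_filter/cF.
  + exact/cvg_at_left_filter/cF.
- by move=> t _; rewrite derive1E; case: (dF t).
Qed.

(** The value |g + d e^(it)|^2 for d = d1 + i d2. *)
Definition factor_sqr {R : realType} (g d1 d2 t : R) : R :=
  g ^+ 2 + d1 ^+ 2 + d2 ^+ 2 + 2 * g * (d1 * cos t - d2 * sin t).

(** The algebra behind the primitive of 1 / (n^2 + m^2), where n and m are the
    real and imaginary parts of g + d e^(it), so that n' = - m, m' = n - g and
    g^2 - |d|^2 = 2 g n - n^2 - m^2. *)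
Lemma atan_algebra {F : fieldType} (n m g : F) :
  n != 0 -> 2 * g * n - n ^+ 2 - m ^+ 2 != 0 -> 1 + (m / n) ^+ 2 != 0 -> n ^+ 2 + m ^+ 2 != 0 ->
  (2 * g * n - n ^+ 2 - m ^+ 2)^-1 * (1 - 2 * ((1 + (m / n) ^+ 2)^-1 *
    (m * (- n ^- 2 * - m) + n^-1 * (n - g)))) = (n ^+ 2 + m ^+ 2)^-1.
Proof.
by move=> n0 q0 r0 s0; field; rewrite n0 q0 s0.
Qed.

Section PoissonIntegrals.
Context {R : realType} (g d1 d2 : R).
Hypotheses (g0 : 0 < g) (dg : d1 ^+ 2 + d2 ^+ 2 < g ^+ 2).

(* [N] and [M] are the real and imaginary parts of g + d e^(it). *)
Let N t := g + (d1 * cos t - d2 * sin t).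
Let M t := d1 * sin t + d2 * cos t.

Lemma sqr_gap_gt0 : 0 < g ^+ 2 - d1 ^+ 2 - d2 ^+ 2.
Proof. by rewrite -addrA -opprD subr_gt0. Qed.

Lemma factor_sqrE t : factor_sqr g d1 d2 t = N t ^+ 2 + M t ^+ 2.
Proof.
have h := cos2sin2 t; rewrite /factor_sqr /N /M.
by ring: h.
Qed.

Lemma re_factor_gt0 t : 0 < N t.
Proof.
have h := cos2sin2 t.
have e : (d1 * cos t - d2 * sin t) ^+ 2 + M t ^+ 2 = d1 ^+ 2 + d2 ^+ 2 by rewrite /M; ring: h.
have : `|d1 * cos t - d2 * sin t| < g.
  rewrite -(@ltr_pXn2r _ 2)// ?nnegrE ?ltW// real_normK ?num_real//.
  by apply: le_lt_trans dg; rewrite -e lerDl sqr_ge0.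
by rewrite ltr_norml /N; lra.
Qed.

Lemma factor_sqr_gt0 t : 0 < factor_sqr g d1 d2 t.
Proof. by rewrite factor_sqrE ltr_pwDl ?sqr_ge0// exprn_gt0 ?re_factor_gt0. Qed.

Lemma is_derive_factor_sqr t :
  is_derive (t : R) (1 : R) (factor_sqr g d1 d2) (- 2 * g * M t).
Proof. by rewrite /factor_sqr; apply: is_derive_eq; rewrite /M /GRing.scale/=; ring. Qed.

Lemma is_derive_re_factor t : is_derive (t : R) (1 : R) N (- M t).
Proof. by rewrite /N; apply: is_derive_eq; rewrite /M /GRing.scale/=; ring. Qed.

Lemma is_derive_im_factor t : is_derive (t : R) (1 : R) M (N t - g).
Proof. by rewrite /M; apply: is_derive_eq; rewrite /N /GRing.scale/=; ring. Qed.

Lemma continuous_factor_sqrV : continuous (fun t => (factor_sqr g d1 d2 t)^-1).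
Proof.
move=> t; apply: cvgV; first by rewrite gt_eqF ?factor_sqr_gt0.
by apply/differentiable_continuous/derivable1_diffP; case: (is_derive_factor_sqr t).
Qed.

(* Since N > 0, atan (M / N) is a smooth argument of g + d e^(it). *)
Let G t := (t - 2 * atan (M t / N t)) / (g ^+ 2 - d1 ^+ 2 - d2 ^+ 2).

Lemma is_derive_poisson_primitive t : is_derive (t : R) (1 : R) G (factor_sqr g d1 d2 t)^-1.
Proof.
have n0 : N t != 0 by rewrite gt_eqF ?re_factor_gt0.
have := is_derive_re_factor t; have := is_derive_im_factor t => dM dN.
have dV : is_derive (t : R) (1 : R) (fun t => (N t)^-1) (- (N t) ^- 2 *: - M t).
  exact: is_deriveV.
rewrite /G; apply: is_derive_eq; rewrite /GRing.scale/=.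
have q0 : g ^+ 2 - d1 ^+ 2 - d2 ^+ 2 != 0 by rewrite gt_eqF ?sqr_gap_gt0.
have p0 : factor_sqr g d1 d2 t != 0 by rewrite gt_eqF ?factor_sqr_gt0.
have p0' : N t ^+ 2 + M t ^+ 2 != 0 by rewrite -factor_sqrE.
have e : g ^+ 2 - d1 ^+ 2 - d2 ^+ 2 = 2 * g * N t - N t ^+ 2 - M t ^+ 2.
  by have h := cos2sin2 t; rewrite /N /M; ring: h.
rewrite factor_sqrE mulr0 add0r; rewrite e in q0 *.
apply: atan_algebra => //; exact: lt0r_neq0 (ltr_pwDl ltr01 (sqr_ge0 _)).
Qed.

Lemma Rintegral_poisson :
  \int[@lebesgue_measure R]_(t in `[0, 2 * pi]) (factor_sqr g d1 d2 t)^-1 =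
    2 * pi / (g ^+ 2 - d1 ^+ 2 - d2 ^+ 2).
Proof.
rewrite (Rintegral_period _ _ continuous_factor_sqrV is_derive_poisson_primitive) /G /N /M.
rewrite mulr_natl cos2pi sin2pi cos0 sin0 -mulr_natl.
by field; rewrite !gt_eqF ?sqr_gap_gt0//.
Qed.

Lemma is_derive_ln_factor_sqr t :
  is_derive (t : R) (1 : R) (fun t => ln (factor_sqr g d1 d2 t))
    ((factor_sqr g d1 d2 t)^-1 * (- 2 * g * M t)).
Proof.
have dl := @is_derive1_ln _ _ (factor_sqr_gt0 t).
have dp := is_derive_factor_sqr t.
exact: is_derive_eq.
Qed.

Let A := (g ^+ 2 + d1 ^+ 2 + d2 ^+ 2).

Lemma Rintegral_poisson_cos :
  \int[@lebesgue_measure R]_(t in `[0, 2 * pi]) (cos t * (factor_sqr g d1 d2 t)^-1) =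
    2 * pi * (- d1 / g) / (g ^+ 2 - d1 ^+ 2 - d2 ^+ 2).
Proof.
have cf : continuous (fun t => cos t * (factor_sqr g d1 d2 t)^-1).
  by move=> t; apply: cvgM; [exact: continuous_cos|exact: continuous_factor_sqrV].
have [[d10 d20]|d_neq0] : (d1 = 0 /\ d2 = 0) \/ d1 ^+ 2 + d2 ^+ 2 != 0.
  have [/eqP|] := eqVneq (d1 ^+ 2 + d2 ^+ 2) 0; last by right.
    by rewrite paddr_eq0 ?sqr_ge0// !sqrf_eq0 => /andP[/eqP ? /eqP ?]; left.
  have dF t : is_derive (t : R) (1 : R) (fun t => g ^- 2 * sin t) (cos t * (factor_sqr g d1 d2 t)^-1).
    apply: is_derive_eq; rewrite /GRing.scale /factor_sqr d10 d20/=.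
    by field; rewrite gt_eqF.
  rewrite (Rintegral_period _ _ cf dF) mulr_natl sin2pi sin0 d10.
  by rewrite !(oppr0, mul0r, mulr0, subr0).
(* |d|^2 cos t is d1 Re (d e^(it)) + d2 Im (d e^(it)); divided by
   |g + d e^(it)|^2, the first term is affine in the Poisson kernel and the
   second is a logarithmic derivative. *)
pose F t := (d1 * ((t - A * G t) / (2 * g)) - d2 * (ln (factor_sqr g d1 d2 t) / (2 * g))) /
  (d1 ^+ 2 + d2 ^+ 2).
have dF t : is_derive (t : R) (1 : R) F (cos t * (factor_sqr g d1 d2 t)^-1).
  have dG := is_derive_poisson_primitive t; have dL := is_derive_ln_factor_sqr t.
  rewrite /F; apply: is_derive_eq; rewrite /GRing.scale /=.
  have p0 : factor_sqr g d1 d2 t != 0 by rewrite gt_eqF ?factor_sqr_gt0.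
  have e : factor_sqr g d1 d2 t = A + 2 * g * (d1 * cos t - d2 * sin t) by [].
  rewrite e in p0 *; rewrite /M.
  field.
  by rewrite p0 d_neq0 gt_eqF.
rewrite (Rintegral_period _ _ cf dF) /F /G /factor_sqr /M /N.
rewrite mulr_natl cos2pi sin2pi cos0 sin0 -mulr_natl /A.
by field; rewrite d_neq0 !gt_eqF ?sqr_gap_gt0//.
Qed.

Lemma Rintegral_poisson_sin :
  \int[@lebesgue_measure R]_(t in `[0, 2 * pi]) (sin t * (factor_sqr g d1 d2 t)^-1) =
    2 * pi * (d2 / g) / (g ^+ 2 - d1 ^+ 2 - d2 ^+ 2).
Proof.
have cf : continuous (fun t => sin t * (factor_sqr g d1 d2 t)^-1).
  by move=> t; apply: cvgM; [exact: continuous_sin|exact: continuous_factor_sqrV].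
have [[d10 d20]|d_neq0] : (d1 = 0 /\ d2 = 0) \/ d1 ^+ 2 + d2 ^+ 2 != 0.
  have [/eqP|] := eqVneq (d1 ^+ 2 + d2 ^+ 2) 0; last by right.
    by rewrite paddr_eq0 ?sqr_ge0// !sqrf_eq0 => /andP[/eqP ? /eqP ?]; left.
  have dF t : is_derive (t : R) (1 : R) (fun t => - g ^- 2 * cos t) (sin t * (factor_sqr g d1 d2 t)^-1).
    apply: is_derive_eq; rewrite /GRing.scale /factor_sqr d10 d20/=.
    by field; rewrite gt_eqF.
  rewrite (Rintegral_period _ _ cf dF) mulr_natl cos2pi cos0 d20.
  by rewrite !(subrr, mul0r, mulr0).
(* Here |d|^2 sin t is d1 Im (d e^(it)) - d2 Re (d e^(it)). *)
pose F t := (- d2 * ((t - A * G t) / (2 * g)) - d1 * (ln (factor_sqr g d1 d2 t) / (2 * g))) /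
  (d1 ^+ 2 + d2 ^+ 2).
have dF t : is_derive (t : R) (1 : R) F (sin t * (factor_sqr g d1 d2 t)^-1).
  have dG := is_derive_poisson_primitive t; have dL := is_derive_ln_factor_sqr t.
  rewrite /F; apply: is_derive_eq; rewrite /GRing.scale /=.
  have p0 : factor_sqr g d1 d2 t != 0 by rewrite gt_eqF ?factor_sqr_gt0.
  have e : factor_sqr g d1 d2 t = A + 2 * g * (d1 * cos t - d2 * sin t) by [].
  rewrite e in p0 *; rewrite /M.
  field.
  by rewrite p0 d_neq0 gt_eqF.
rewrite (Rintegral_period _ _ cf dF) /F /G /factor_sqr /M /N.
rewrite mulr_natl cos2pi sin2pi cos0 sin0 -mulr_natl /A.
by field; rewrite d_neq0 !gt_eqF ?sqr_gap_gt0//.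
Qed.

End PoissonIntegrals.

(** * Iterated integrals over a rectangle *)

Lemma Rintegral_setX_itv {R : realType} (a b c d : R) (F : R * R -> R) :
  measurable_fun [set: measurableTypeR R * measurableTypeR R] F -> continuous F ->
  \int[(@lebesgue_measure R \x @lebesgue_measure R)%E]_(x in `[a, b] `*` `[c, d]) F x =
  \int[@lebesgue_measure R]_(s in `[a, b]) \int[@lebesgue_measure R]_(t in `[c, d]) F (s, t).
Proof.
move=> mF cF.
pose mu := @lebesgue_measure R.
have mI u v : measurable (`[u, v] : set (measurableTypeR R)) by exact: measurable_itv.
have fI u v : (mu `[u, v]%classic < +oo)%E.
  by rewrite /mu lebesgue_measure_itv/= lte_fin; case: ifP => // _; rewrite -EFinB ltry.
have mD : measurable (`[a, b] `*` `[c, d] : set (measurableTypeR R * measurableTypeR R)).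
  exact: measurableX.
have iF : (mu \x mu)%E.-integrable (`[a, b] `*` `[c, d]) (EFin \o F).
  apply: measurable_bounded_integrable => //.
  - rewrite [X in (X < _)%E](product_measure1E mu mu (mI a b) (mI c d)).
    by rewrite lte_mul_pinfty// ge0_fin_numE.
  - exact: measurable_funTS.
  - have cD : compact (`[a, b] `*` `[c, d] : set (R * R)).
      by apply: compact_setX; exact: segment_compact.
    have /compact_bounded[M [_ mrt]] := continuous_compact (continuous_subspaceT cF) cD.
    by exists M; split; rewrite ?num_real // => ? ? ? ?; exact: mrt.
have cF1 s : continuous (fun t => F (s, t)).
  move=> t; apply: (@continuous_comp _ _ _ (fun t => (s, t)) F); last exact: cF.
  by apply: (@cvg_pair _ _ _ (nbhs t) (nbhs s) (nbhs t)); [exact: cvg_cst|exact: cvg_id].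
have iF1 s : mu.-integrable `[c, d] (EFin \o (fun t => F (s, t))).
  apply: continuous_compact_integrable; first exact: segment_compact.
  exact: continuous_subspaceT.
rewrite {1}/Rintegral integral_mkcond -integral12_prod_meas1; last by apply/(integrable_mkcond _ mD).
rewrite /Rintegral; congr fine; rewrite [RHS]integral_mkcond.
apply: eq_integral => s _; rewrite /fubini_F [RHS]patchE.
have [sab|sab] := boolP (s \in `[a, b]%classic).
  rewrite fineK; last exact: integrable_fin_num (iF1 s).
  rewrite [RHS]integral_mkcond; apply: eq_integral => t _; rewrite !patchE.
  by rewrite in_setX sab.
rewrite integral0_eq// => t _; rewrite patchE in_setX/=.
by rewrite (negbTE sab).
Qed.

(** * Fourier coefficients of the inverse square modulus *)

(** The coefficients p0, p1 and the polynomial g + (d1 + i d2) z are related by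
    |p0|^2 + 2 Re (p1 conj(p0) z) = |g + (d1 + i d2) z|^2 on the unit circle,
    the right-hand polynomial having no zero in the closed disk and being
    normalized by g > 0. *)
Definition factor_pair {R : realType} (p0 p1 : R[i]) (g d1 d2 : R) : Prop :=
  [/\ 0 < g, d1 ^+ 2 + d2 ^+ 2 < g ^+ 2,
      `|p0| ^+ 2 = (g ^+ 2 + d1 ^+ 2 + d2 ^+ 2)%:C &
      p1 * p0^* = (g * d1) +i* (g * d2)].

(** The real number |p (e^(i s), e^(i t))|^2 at x = (s, t). *)
Definition torus_sqr {R : realType} (p0 p1 : R[i]) (x : R * R) : R :=
  let q := symm1 p0 p1 (expi x.1) (expi x.2) in complex.Re q ^+ 2 + complex.Im q ^+ 2.

Lemma torus_sqrE {R : realType} (u0 v0 u1 v1 : R) (x : R * R) :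
  torus_sqr (u0 +i* v0) (u1 +i* v1) x =
  (u0 + (u1 * (cos x.1 + cos x.2) - v1 * (sin x.1 + sin x.2))) ^+ 2 +
  (v0 + (u1 * (sin x.1 + sin x.2) + v1 * (cos x.1 + cos x.2))) ^+ 2.
Proof. by []. Qed.

Section Fourier.
Context {R : realType} (p0 p1 : R[i]) (g d1 d2 : R).
Hypothesis fp : factor_pair p0 p1 g d1 d2.

Lemma factor_pair_coords : [/\ complex.Re p0 ^+ 2 + complex.Im p0 ^+ 2 = g ^+ 2 + d1 ^+ 2 + d2 ^+ 2,
  complex.Re p1 * complex.Re p0 + complex.Im p1 * complex.Im p0 = g * d1 &
  complex.Im p1 * complex.Re p0 - complex.Re p1 * complex.Im p0 = g * d2].
Proof.
case: fp => _ _; rewrite -add_Re2_Im2 => /complexI ->.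
case: p0 p1 => [u0 v0] [u1 v1] /= [] <- <-; split=> //; ring.
Qed.

(** For fixed z1 = e^(is), |p (z1, .)|^2 = |alpha + p1 z2|^2 with
    alpha = p0 + p1 z1.  After rotating alpha onto the positive axis it becomes
    |h + e z2|^2 with h = |alpha| and h e = p1 conj(alpha), and
    h^2 - |e|^2 = |alpha|^2 - |p1|^2 = |g + d z1|^2. *)
Lemma torus_sqr_section (s : R) : exists h e1 e2 : R,
  [/\ 0 < h, e1 ^+ 2 + e2 ^+ 2 < h ^+ 2,
      h ^+ 2 - e1 ^+ 2 - e2 ^+ 2 = factor_sqr g d1 d2 s &
      forall t, torus_sqr p0 p1 (s, t) = factor_sqr h e1 e2 t].
Proof.
have [g0 dg _ _] := fp; have [] := factor_pair_coords.
case: p0 p1 => [u0 v0] [u1 v1] /= E0 E1 E2.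
have k0 := factor_sqr_gt0 _ _ _ g0 dg s.
pose al := u0 + u1 * cos s - v1 * sin s.
pose be := v0 + u1 * sin s + v1 * cos s.
have c1 := cos2sin2 s.
have nE : al ^+ 2 + be ^+ 2 = factor_sqr g d1 d2 s + (u1 ^+ 2 + v1 ^+ 2).
  have -> : factor_sqr g d1 d2 s = u0 ^+ 2 + v0 ^+ 2 + 2 * ((u1 * u0 + v1 * v0) * cos s
     - (v1 * u0 - u1 * v0) * sin s) by rewrite E0 E1 E2 /factor_sqr; ring.
  by rewrite /al /be; ring: c1.
have n0 : 0 < al ^+ 2 + be ^+ 2 by rewrite nE ltr_pwDl// addr_ge0// sqr_ge0.
pose h := Num.sqrt (al ^+ 2 + be ^+ 2).
have h0 : 0 < h by rewrite sqrtr_gt0.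
have hE : h ^+ 2 = al ^+ 2 + be ^+ 2 by rewrite sqr_sqrtr// ltW.
have h2 : h ^+ 2 != 0 by rewrite gt_eqF// exprn_gt0.
have eE : ((u1 * al + v1 * be) / h) ^+ 2 + ((v1 * al - u1 * be) / h) ^+ 2 = u1 ^+ 2 + v1 ^+ 2.
  rewrite !expr_div_n -mulrDl; apply: (mulIf h2); rewrite divfK// hE; ring.
exists h, ((u1 * al + v1 * be) / h), ((v1 * al - u1 * be) / h); split=> //.
- by rewrite eE hE nE ltrDr.
- by rewrite -addrA -opprD eE hE nE addrK.
- move=> t; rewrite torus_sqrE /factor_sqr /= -[h ^+ 2 + _ + _]addrA eE hE.
  have ct := cos2sin2 t.
  have -> : 2 * h * ((u1 * al + v1 * be) / h * cos t - (v1 * al - u1 * be) / h * sin t)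
    = 2 * ((u1 * al + v1 * be) * cos t - (v1 * al - u1 * be) * sin t).
    by field; rewrite gt_eqF.
  by rewrite /al /be; ring: ct.
Qed.

Lemma torus_sqr_gt0 x : 0 < torus_sqr p0 p1 x.
Proof.
case: x => s t; have [h [e1 [e2 [h0 eh _ ->]]]] := torus_sqr_section s.
exact: factor_sqr_gt0.
Qed.

Lemma continuous_torus_sqr : continuous (torus_sqr p0 p1).
Proof.
case: p0 p1 => [u0 v0] [u1 v1].
have cc i : continuous (fun x : R * R => cos (if i then x.1 else x.2)).
  by move=> x; apply: continuous_comp; [case: i; [exact: cvg_fst|exact: cvg_snd]|exact: continuous_cos].
have cs i : continuous (fun x : R * R => sin (if i then x.1 else x.2)).
  by move=> x; apply: continuous_comp; [case: i; [exact: cvg_fst|exact: cvg_snd]|exact: continuous_sin].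
have Cc (c : R) : continuous (fun _ : R * R => c) by move=> ?; exact: cvg_cst.
have cA (f h : R * R -> R) : continuous f -> continuous h -> continuous (fun x : R * R => f x + h x : R).
  by move=> cf ch x; apply: cvgD; [exact: cf|exact: ch].
have cM (f h : R * R -> R) : continuous f -> continuous h -> continuous (fun x : R * R => f x * h x : R).
  by move=> cf ch x; apply: cvgM; [exact: cf|exact: ch].
have cN (f : R * R -> R) : continuous f -> continuous (fun x : R * R => - f x : R).
  by move=> cf x; apply: cvgN; exact: cf.
have sq (f : R * R -> R) : continuous f -> continuous (fun x : R * R => f x ^+ 2 : R).
  by move=> cf; exact: (cM f f).
have [c1 c2 s1 s2] := And4 (cc true) (cc false) (cs true) (cs false).
pose lin := fun k f h (cf : continuous f) (ch : continuous h) => cM _ _ (Cc k) (cA f h cf ch).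
apply: (cA _ _ (sq _ (cA _ _ (Cc u0) (cA _ _ (lin u1 _ _ c1 c2) (cN _ (lin v1 _ _ s1 s2)))))
  (sq _ (cA _ _ (Cc v0) (cA _ _ (lin u1 _ _ s1 s2) (lin v1 _ _ c1 c2))))).
Qed.

Lemma measurable_torus_sqr :
  measurable_fun [set: measurableTypeR R * measurableTypeR R] (torus_sqr p0 p1).
Proof.
case: p0 p1 => [u0 v0] [u1 v1].
have m1 : measurable_fun [set: measurableTypeR R * measurableTypeR R] (fun x : R * R => x.1) by exact: measurable_fst.
have m2 : measurable_fun [set: measurableTypeR R * measurableTypeR R] (fun x : R * R => x.2) by exact: measurable_snd.
have mc : measurable_fun [set: measurableTypeR R] (@cos R) by apply: continuous_measurable_fun; exact: continuous_cos.
have ms : measurable_fun [set: measurableTypeR R] (@sin R) by apply: continuous_measurable_fun; exact: continuous_sin.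
have mC1 := measurableT_comp mc m1.
have mC2 := measurableT_comp mc m2.
have mS1 := measurableT_comp ms m1.
have mS2 := measurableT_comp ms m2.
have lin k (f h : measurableTypeR R * measurableTypeR R -> R) (mf : measurable_fun setT f)
    (mh : measurable_fun setT h) : measurable_fun setT (fun x => k * (f x + h x)).
  exact: measurable_funM (measurable_cst k) (measurable_funD mf mh).
exact: measurable_funD
  (measurable_funX 2 (measurable_funD (measurable_cst u0)
     (measurable_funB (lin u1 _ _ mC1 mC2) (lin v1 _ _ mS1 mS2))))
  (measurable_funX 2 (measurable_funD (measurable_cst v0)
     (measurable_funD (lin u1 _ _ mS1 mS2) (lin v1 _ _ mC1 mC2)))).
Qed.

(** Integrating out the second variable. *)
Lemma Rintegral_torus (c : R -> R) : continuous c ->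
  \int[(@lebesgue_measure R \x @lebesgue_measure R)%E]_(x in `[0, 2 * pi] `*` `[0, 2 * pi])
    (c x.1 * (torus_sqr p0 p1 x)^-1) =
  2 * pi * \int[@lebesgue_measure R]_(s in `[0, 2 * pi]) (c s * (factor_sqr g d1 d2 s)^-1).
Proof.
move=> cc; have [g0 dg _ _] := fp.
rewrite Rintegral_setX_itv.
- rewrite -RintegralZl//=; last first.
    apply: continuous_compact_integrable; first exact: segment_compact.
    apply: continuous_subspaceT => s; apply: cvgM; first exact: cc.
    exact: continuous_factor_sqrV.
  apply: eq_Rintegral => s _ /=.
  have [h [e1 [e2 [h0 eh hE tE]]]] := torus_sqr_section s.
  under eq_Rintegral do rewrite tE.
  rewrite RintegralZl//=; last first.
    apply: continuous_compact_integrable; first exact: segment_compact.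
    by apply: continuous_subspaceT; exact: continuous_factor_sqrV.
  by rewrite Rintegral_poisson// hE mulrCA mulrA.
- have mV : measurable_fun [set: measurableTypeR R * measurableTypeR R]
      (fun x => (torus_sqr p0 p1 x)^-1).
    have -> : (fun x => (torus_sqr p0 p1 x)^-1) = (fun x => torus_sqr p0 p1 x `^ (-1)).
      by apply/funext => x; rewrite powR_inv1// ltW// torus_sqr_gt0.
    exact: measurableT_comp (measurable_powR _) measurable_torus_sqr.
  have mc : measurable_fun [set: measurableTypeR R] c by exact: continuous_measurable_fun.
  have m1 : measurable_fun [set: measurableTypeR R * measurableTypeR R] (fun x : R * R => x.1) by exact: measurable_fst.
  exact: measurable_funM (measurableT_comp mc m1) mV.
- move=> x; apply: cvgM.
    by apply: (@continuous_comp _ _ _ fst c); [exact: cvg_fst|exact: cc].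
  by apply: cvgV; [rewrite gt_eqF ?torus_sqr_gt0|exact: continuous_torus_sqr].
Qed.

Lemma inv_sqr_norm_torus x : inv_sqr_norm (symm1 p0 p1) (expi x.1) (expi x.2) =
  ((torus_sqr p0 p1 x)^-1)%:C.
Proof. by rewrite /inv_sqr_norm -add_Re2_Im2 -fmorphV. Qed.

Lemma expi_neq0 (t : R) : expi t != 0.
Proof.
rewrite eq_complex/=; apply/negP => /andP[/eqP c0 /eqP s0].
by have := cos2Dsin2 t; rewrite c0 s0 expr0n/= addr0 => /eqP; rewrite eq_sym oner_eq0.
Qed.

Lemma expiV (t : R) : (expi t)^-1 = cos t +i* (- sin t).
Proof.
apply: (mulfI (expi_neq0 t)); rewrite mulfV ?expi_neq0//.
by apply/eqP; rewrite eq_complex/= mulrN opprK -!expr2 cos2Dsin2 eqxx mulrN mulrC addNr eqxx.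
Qed.

Lemma fourier_coef00 : fourier_coef (inv_sqr_norm (symm1 p0 p1)) 0 0 =
  ((g ^+ 2 - d1 ^+ 2 - d2 ^+ 2)^-1)%:C.
Proof.
have [g0 dg _ _] := fp.
rewrite /fourier_coef /square_integral.
have e (x : R * R) : inv_sqr_norm (symm1 p0 p1) (expi x.1) (expi x.2) *
    expi x.1 ^ (- 0) * expi x.2 ^ (- 0) =
    (1 * (torus_sqr p0 p1 x)^-1) +i* (0 * (torus_sqr p0 p1 x)^-1).
  by rewrite oppr0 !expr0z !mulr1 inv_sqr_norm_torus mul1r mul0r.
under eq_Rintegral do rewrite e/=.
under [in X in _ +i* X]eq_Rintegral do rewrite e/=.
rewrite (Rintegral_torus (fun=> 1)); last by move=> ?; exact: cvg_cst.
rewrite (Rintegral_torus (fun=> 0)); last by move=> ?; exact: cvg_cst.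
under eq_Rintegral do rewrite mul1r.
under [in X in _ +i* X]eq_Rintegral do rewrite mul0r.
rewrite Rintegral_poisson// Rintegral_cst//= mul0r mulr0.
rewrite complexr0 -rmorphM/=; congr (_%:C).
by move: (@pi R) (pi_gt0 R) => P P0; field; rewrite ?sqr_gap_gt0 !gt_eqF ?sqr_gap_gt0.
Qed.

Lemma fourier_coef10 : fourier_coef (inv_sqr_norm (symm1 p0 p1)) 1 0 =
  ((- d1 / g) +i* (- d2 / g)) * ((g ^+ 2 - d1 ^+ 2 - d2 ^+ 2)^-1)%:C.
Proof.
have [g0 dg _ _] := fp.
rewrite /fourier_coef /square_integral.
have e (x : R * R) : inv_sqr_norm (symm1 p0 p1) (expi x.1) (expi x.2) *
    expi x.1 ^ (- 1) * expi x.2 ^ (- 0) =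
    (cos x.1 * (torus_sqr p0 p1 x)^-1) +i* (- sin x.1 * (torus_sqr p0 p1 x)^-1).
  rewrite oppr0 expr0z mulr1 inv_sqr_norm_torus -[_ ^ (-1)]/((expi x.1)^-1) expiV.
  by apply/eqP; rewrite eq_complex/= !mul0r subr0 addr0 mulrC eqxx mulrC eqxx.
under eq_Rintegral do rewrite e/=.
under [in X in _ +i* X]eq_Rintegral do rewrite e/=.
rewrite (Rintegral_torus _ (@continuous_cos R)) (Rintegral_torus (fun t => - sin t)); last first.
  by move=> ?; apply: cvgN; exact: continuous_sin.
rewrite Rintegral_poisson_cos//.
under eq_Rintegral do rewrite mulNr -mulrN1.
rewrite RintegralZr//=; last first.
  apply: continuous_compact_integrable; first exact: segment_compact.
  apply: continuous_subspaceT => s; apply: cvgM; first exact: continuous_sin.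
  exact: continuous_factor_sqrV.
rewrite Rintegral_poisson_sin//.
apply/eqP; rewrite eq_complex/= !mul0r !mulr0 !subr0 !addr0; apply/andP; split; apply/eqP;
by move: (@pi R) (pi_gt0 R) => P P0; field; rewrite ?sqr_gap_gt0 !gt_eqF ?sqr_gap_gt0.
Qed.

End Fourier.

(** * Stability and spectral factorization *)

Lemma normc_sqr {R : realType} (z : R[i]) :
  `|z| ^+ 2 = (complex.Re z ^+ 2 + complex.Im z ^+ 2)%:C.
Proof. by rewrite add_Re2_Im2. Qed.

Lemma normc_ltP {R : realType} (a : R) (b : R[i]) :
  `|b| < a%:C <-> 0 < a /\ complex.Re b ^+ 2 + complex.Im b ^+ 2 < a ^+ 2.
Proof.
split=> [ba|[a0 ba]].
  have a0 : 0 < a by rewrite -ltcR; apply: le_lt_trans ba; exact: normr_ge0.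
  split=> //; rewrite -ltcR -normc_sqr rmorphXn /=.
  by rewrite ltr_pXn2r// nnegrE ?normr_ge0// ler0c ltW.
rewrite -(@ltr_pXn2r _ 2)// ?nnegrE ?ler0c ?ltW//.
by rewrite normc_sqr -rmorphXn/= ltcR.
Qed.

Lemma stable_symm1P {R : realType} (p0 p1 : R[i]) :
  stable (symm1 p0 p1) <-> 2 * `|p1| < `|p0|.
Proof.
split=> [st|p10 z1 z2 z1le z2le]; last first.
  rewrite /symm1; apply/negP => /eqP/(canRL (addrK _)); rewrite sub0r => p0E.
  have zz : `|z1 + z2| <= 2.
    by apply: le_trans (ler_normD _ _) _; rewrite -[2]/(1 + 1) lerD.
  have : `|p0| <= 2 * `|p1|.
    by rewrite p0E normrN normrM mulrC ler_wpM2r ?normr_ge0.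
  by move/(lt_le_trans p10); rewrite ltxx.
rewrite real_ltNge ?realM ?normr_real//; apply/negP => p01.
have [p1_0|p1_neq0] := eqVneq p1 0.
  move: p01; rewrite p1_0 normr0 mulr0 normr_le0 => /eqP p00.
  by have := st 0 0; rewrite normr0 ler01 /symm1 p00 p1_0 mul0r addr0 eqxx => /(_ isT isT).
(* The point (z, z) with z = - p0 / (2 p1) is a zero of p. *)
have zle : `|- p0 / (2 * p1)| <= 1.
  rewrite normrM normrN normfV ler_pdivrMr ?normr_gt0 ?mulf_neq0// ?pnatr_eq0//.
  by rewrite mul1r normrM ger0_norm.
move/negP: (st _ _ zle zle); apply; apply/eqP; rewrite /symm1.
by field.
Qed.

Lemma stable_sqrP {R : realType} (p0 p1 : R[i]) :
  stable (symm1 p0 p1) <->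
  4 * (complex.Re p1 ^+ 2 + complex.Im p1 ^+ 2) < complex.Re p0 ^+ 2 + complex.Im p0 ^+ 2.
Proof.
apply: (iff_trans (stable_symm1P _ _)).
rewrite -(@ltr_pXn2r _ 2)// ?nnegrE// ?mulr_ge0// exprMn !normc_sqr.
have -> : 2 ^+ 2 = (4 : R)%:C by rewrite rmorph_nat -natrX.
by rewrite -rmorphM/= ltcR.
Qed.

Lemma factor_pair_stable {R : realType} (p0 p1 : R[i]) (g d1 d2 : R) :
  factor_pair p0 p1 g d1 d2 -> stable (symm1 p0 p1).
Proof.
move=> fp; have [g0 dg _ _] := fp; have [E0 E1 E2] := factor_pair_coords _ _ _ _ _ fp.
apply/stable_sqrP.
set P1 := complex.Re p1 ^+ 2 + _; set P0 := complex.Re p0 ^+ 2 + _ in E0 *.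
have PP : P0 * P1 = g ^+ 2 * (d1 ^+ 2 + d2 ^+ 2).
  transitivity ((g * d1) ^+ 2 + (g * d2) ^+ 2); last by ring.
  by rewrite -E1 -E2 /P0 /P1; ring.
have P00 : 0 < P0 by rewrite E0 -addrA ltr_pwDl ?exprn_gt0 ?addr_ge0 ?sqr_ge0.
rewrite -(ltr_pM2l P00) mulrCA PP -subr_gt0.
have -> : P0 * P0 - 4 * (g ^+ 2 * (d1 ^+ 2 + d2 ^+ 2)) = (g ^+ 2 - d1 ^+ 2 - d2 ^+ 2) ^+ 2.
  by rewrite E0; ring.
by rewrite exprn_gt0 ?sqr_gap_gt0.
Qed.

Lemma stable_factor_pair {R : realType} (p0 p1 : R[i]) :
  stable (symm1 p0 p1) -> exists g d1 d2, factor_pair p0 p1 g d1 d2.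
Proof.
move/stable_sqrP; rewrite /factor_pair normc_sqr.
case: p0 p1 => [u0 v0] [u1 v1] /=.
set P0 := u0 ^+ 2 + v0 ^+ 2; set P1 := u1 ^+ 2 + v1 ^+ 2 => P10.
have P1ge : 0 <= P1 by rewrite addr_ge0// sqr_ge0.
have P0gt : 0 < P0 by apply: le_lt_trans P10; rewrite mulr_ge0.
have W0 : 0 < P0 ^+ 2 - 4 * (P0 * P1) by rewrite mulrCA -mulrBr mulr_gt0// subr_gt0.
(* g^2 and |d|^2 are the two roots of X^2 - |p0|^2 X + |p0 p1|^2; taking the
   larger one for g^2 gives |d| < g. *)
pose w := Num.sqrt (P0 ^+ 2 - 4 * (P0 * P1)).
have w0 : 0 < w by rewrite sqrtr_gt0.
have wE : w ^+ 2 = P0 ^+ 2 - 4 * (P0 * P1) by rewrite sqr_sqrtr// ltW.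
have G0 : 0 < (P0 + w) / 2 by apply: divr_gt0 => //; exact: addr_gt0.
pose g := Num.sqrt ((P0 + w) / 2).
have g0 : 0 < g by rewrite sqrtr_gt0.
have gE : g ^+ 2 = (P0 + w) / 2 by rewrite sqr_sqrtr// ltW.
pose y1 := u1 * u0 + v1 * v0; pose y2 := v1 * u0 - u1 * v0.
have yE : y1 ^+ 2 + y2 ^+ 2 = P0 * P1 by rewrite /y1 /y2 /P0 /P1; ring.
have dE : (y1 / g) ^+ 2 + (y2 / g) ^+ 2 = (P0 - w) / 2.
  rewrite !expr_div_n -mulrDl yE gE.
  have -> : P0 * P1 = (P0 ^+ 2 - w ^+ 2) / 4 by rewrite wE; field.
  by field; rewrite gt_eqF// addr_gt0.
have gn0 : g != 0 by rewrite gt_eqF.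
exists g, (y1 / g), (y2 / g); split=> //.
- by rewrite dE gE; lra.
- by congr (_%:C); rewrite -addrA dE gE; field.
- rewrite ![g * (_ / g)]mulrCA divff// !mulr1 /y1 /y2.
  by apply/eqP; rewrite eq_complex/=; apply/andP; split; apply/eqP; ring.
Qed.

(** * The linear system for the coefficients *)

(** The last two equations of the system coincide. *)
Lemma moment_matrixP {R : realType} (a : R) (b p0 p1 : R[i]) :
  moment_matrix a b *m coef_vector p0 p1 = \col_i nth 0 [:: 1; 0; 0] i <->
  a%:C * `|p0| ^+ 2 + 2 * (b^* * (p1 * p0^*)) = 1 /\
  b * `|p0| ^+ 2 + (a%:C + `|b| ^+ 2 / a%:C) * (p1 * p0^*) = 0.
Proof.
split=> [/matrixP h|[h0 h1]].
  have := h 0 0; have := h 1 0.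
  rewrite !mxE !big_ord_recl !big_ord0 !mxE/= !addr0 => h1 h0; split.
    by rewrite -[RHS]h0; ring.
  by rewrite -[RHS]h1; ring.
apply/matrixP => i j; rewrite !mxE !big_ord_recl !big_ord0 !mxE/= !addr0.
case: i => [[|[|[|//]]]] /= _.
- by rewrite -[RHS]h0; ring.
- by rewrite -[RHS]h1; ring.
- by rewrite -[RHS]h1; ring.
Qed.

Lemma factor_pair_moments {R : realType} (p0 p1 : R[i]) (g d1 d2 : R) (a : R) (b : R[i]) :
  factor_pair p0 p1 g d1 d2 ->
  a = (g ^+ 2 - d1 ^+ 2 - d2 ^+ 2)^-1 ->
  b = ((- d1 / g) +i* (- d2 / g)) * a%:C ->
  `|b| < a%:C /\
  moment_matrix a b *m coef_vector p0 p1 = \col_i nth 0 [:: 1; 0; 0] i.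
Proof.
move=> [g0 dg E0 E1] aE bE.
have q0 := sqr_gap_gt0 _ _ _ dg.
have a0 : 0 < a by rewrite aE invr_gt0.
have gn0 : g != 0 by rewrite gt_eqF.
have qn0 : g ^+ 2 - d1 ^+ 2 - d2 ^+ 2 != 0 by rewrite gt_eqF.
have nb : complex.Re b ^+ 2 + complex.Im b ^+ 2 = (d1 ^+ 2 + d2 ^+ 2) / g ^+ 2 * a ^+ 2.
  by rewrite bE /=; field.
split.
  apply/normc_ltP; split=> //; rewrite nb gtr_pMl ?exprn_gt0//.
  by rewrite ltr_pdivrMr ?exprn_gt0// mul1r.
apply/moment_matrixP; rewrite E0 E1 normc_sqr nb -fmorphV -!rmorphM -rmorphD bE /=.
by split; apply/eqP; rewrite eq_complex/=; apply/andP; split; apply/eqP; rewrite aE; field;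
  rewrite ?gn0 ?qn0.
Qed.

(** Every pair (a, b) with |b| < a comes from a polynomial g + d z: take
    g^2 = a / (a^2 - |b|^2) and d = - b g / a. *)
Lemma moments_factor_pair {R : realType} (a : R) (b : R[i]) :
  `|b| < a%:C ->
  exists g d1 d2, [/\ 0 < g, d1 ^+ 2 + d2 ^+ 2 < g ^+ 2,
    a = (g ^+ 2 - d1 ^+ 2 - d2 ^+ 2)^-1 & b = ((- d1 / g) +i* (- d2 / g)) * a%:C].
Proof.
move=> /normc_ltP; case: b => b1 b2 /= [a0 ba].
set q := a ^+ 2 - (b1 ^+ 2 + b2 ^+ 2); have q0 : 0 < q by rewrite subr_gt0.
pose g := Num.sqrt (a / q); pose d1 := - (b1 * g) / a; pose d2 := - (b2 * g) / a.
have g0 : 0 < g by rewrite sqrtr_gt0 divr_gt0.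
have gE : g ^+ 2 = a / q by rewrite sqr_sqrtr// ltW// divr_gt0.
have an0 : a != 0 by rewrite gt_eqF.
have gn0 : g != 0 by rewrite gt_eqF.
have qn0 : q != 0 by rewrite gt_eqF.
have dE : d1 ^+ 2 + d2 ^+ 2 = (b1 ^+ 2 + b2 ^+ 2) / a ^+ 2 * g ^+ 2 by rewrite /d1 /d2; field.
exists g, d1, d2; split=> //.
- rewrite dE gtr_pMl ?exprn_gt0//.
  by rewrite ltr_pdivrMr ?exprn_gt0// mul1r.
- rewrite -addrA -opprD dE gE; rewrite /q in qn0 *; field.
  by rewrite an0 qn0.
- by apply/eqP; rewrite eq_complex/= /d1 /d2; apply/andP; split; apply/eqP; field; rewrite an0 gn0.
Qed.

(** The linear system has only the solution |p0|^2 = g^2 + |d|^2,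
    p1 conj(p0) = g d: the second equation gives p1 conj(p0) in terms of
    |p0|^2, and the first one then determines |p0|^2. *)
Lemma moment_eq_factor_pair {R : realType} (p0 p1 : R[i]) (a : R) (b : R[i]) (g d1 d2 : R) :
  0 < g -> d1 ^+ 2 + d2 ^+ 2 < g ^+ 2 -> a = (g ^+ 2 - d1 ^+ 2 - d2 ^+ 2)^-1 ->
  b = ((- d1 / g) +i* (- d2 / g)) * a%:C ->
  moment_matrix a b *m coef_vector p0 p1 = \col_i nth 0 [:: 1; 0; 0] i ->
  factor_pair p0 p1 g d1 d2.
Proof.
move=> g0 dg aE bE /moment_matrixP[].
have q0 := sqr_gap_gt0 _ _ _ dg.
have gn0 : g != 0 by rewrite gt_eqF.
have qn0 : g ^+ 2 - d1 ^+ 2 - d2 ^+ 2 != 0 by rewrite gt_eqF.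
have a0 : a != 0 by rewrite aE invr_eq0.
have sn0 : g ^+ 2 + d1 ^+ 2 + d2 ^+ 2 != 0.
  by rewrite gt_eqF// -addrA ltr_pwDl ?exprn_gt0 ?addr_ge0 ?sqr_ge0.
have nb : complex.Re b ^+ 2 + complex.Im b ^+ 2 = (d1 ^+ 2 + d2 ^+ 2) / g ^+ 2 * a ^+ 2.
  by rewrite bE /=; field.
rewrite /factor_pair [`|b| ^+ 2]normc_sqr nb [`|p0| ^+ 2]normc_sqr.
set X := complex.Re p0 ^+ 2 + _; case: (p1 * p0^*) => Y1 Y2 e1 e2.
have c0 : (a%:C + ((d1 ^+ 2 + d2 ^+ 2) / g ^+ 2 * a ^+ 2)%:C / a%:C) =
    (a * (g ^+ 2 + d1 ^+ 2 + d2 ^+ 2) / g ^+ 2)%:C.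
  by rewrite -fmorphV -rmorphM -rmorphD; congr (_%:C); field; rewrite a0 gn0.
move: e1 e2; rewrite c0 bE /= => [] [e1 _] [e2 e3].
set S := g ^+ 2 + d1 ^+ 2 + d2 ^+ 2 in sn0 c0 e2 e3 *.
have k0 : a * S / g ^+ 2 != 0 by rewrite !mulf_neq0 ?invr_neq0 ?expf_neq0.
have Y1E : Y1 = g * d1 * X / S.
  apply: (mulfI k0); transitivity (d1 / g * a * X).
    by apply/eqP; rewrite -subr_eq0 -e2; apply/eqP; ring.
  by field; rewrite sn0 gn0.
have Y2E : Y2 = g * d2 * X / S.
  apply: (mulfI k0); transitivity (d2 / g * a * X).
    by apply/eqP; rewrite -subr_eq0 -e3; apply/eqP; ring.
  by field; rewrite sn0 gn0.
have XE : X = S.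
  have e4 : a * (g ^+ 2 - d1 ^+ 2 - d2 ^+ 2) * X = S.
    rewrite -[RHS]mulr1 -[in RHS]e1 Y1E Y2E; move: (sn0); rewrite /S => sn1.
    by field; rewrite gn0 sn1.
  by rewrite -e4 aE mulVf// mul1r.
by split=> //; rewrite ?XE// Y1E Y2E XE !mulfK.
Qed.

Theorem theorem1p2 (R : realType) (a : R) (b : R[i]) :
  ((exists p0 p1 : R[i],
      [/\ stable (symm1 p0 p1),
          fourier_coef (inv_sqr_norm (symm1 p0 p1)) 0 0 = a%:C &
          fourier_coef (inv_sqr_norm (symm1 p0 p1)) 1 0 = b])
   <-> `|b| < a%:C)
  /\
  (`|b| < a%:C ->
   forall p0 p1 : R[i],
     [/\ stable (symm1 p0 p1),
         fourier_coef (inv_sqr_norm (symm1 p0 p1)) 0 0 = a%:C &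
         fourier_coef (inv_sqr_norm (symm1 p0 p1)) 1 0 = b]
     <-> moment_matrix a b *m coef_vector p0 p1 = \col_i nth 0 [:: 1; 0; 0] i).
Proof.
have direct p0 p1 : [/\ stable (symm1 p0 p1),
      fourier_coef (inv_sqr_norm (symm1 p0 p1)) 0 0 = a%:C &
      fourier_coef (inv_sqr_norm (symm1 p0 p1)) 1 0 = b] ->
    `|b| < a%:C /\
    moment_matrix a b *m coef_vector p0 p1 = \col_i nth 0 [:: 1; 0; 0] i.
  move=> [/stable_factor_pair[g [d1 [d2 fp]]]].
  rewrite (fourier_coef00 _ _ _ _ _ fp) (fourier_coef10 _ _ _ _ _ fp).
  move=> /complexI aE bE; apply: (factor_pair_moments _ _ _ _ _ _ _ fp) => //.
  by rewrite -aE -bE.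
have converse p0 p1 g d1 d2 : factor_pair p0 p1 g d1 d2 ->
    a = (g ^+ 2 - d1 ^+ 2 - d2 ^+ 2)^-1 -> b = ((- d1 / g) +i* (- d2 / g)) * a%:C ->
    [/\ stable (symm1 p0 p1),
      fourier_coef (inv_sqr_norm (symm1 p0 p1)) 0 0 = a%:C &
      fourier_coef (inv_sqr_norm (symm1 p0 p1)) 1 0 = b].
  move=> fp aE bE; split; first exact: factor_pair_stable fp.
  - by rewrite (fourier_coef00 _ _ _ _ _ fp) aE.
  - by rewrite (fourier_coef10 _ _ _ _ _ fp) bE aE.
split; last first.
  move=> ba p0 p1; split=> [/direct[]//|me].
  have [g [d1 [d2 [g0 dg aE bE]]]] := moments_factor_pair a b ba.
  exact: converse (moment_eq_factor_pair _ _ _ _ _ _ _ g0 dg aE bE me) aE bE.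
split=> [[p0 [p1 /direct[]//]]|ba].
have [g [d1 [d2 [g0 dg aE bE]]]] := moments_factor_pair a b ba.
have x0 : 0 < g ^+ 2 + d1 ^+ 2 + d2 ^+ 2.
  by rewrite -addrA ltr_pwDl ?exprn_gt0 ?addr_ge0 ?sqr_ge0.
pose h := Num.sqrt (g ^+ 2 + d1 ^+ 2 + d2 ^+ 2).
have h0 : h != 0 by rewrite gt_eqF// sqrtr_gt0.
(* p0 is determined up to a phase; it is chosen positive. *)
exists h%:C, ((g * d1 / h) +i* (g * d2 / h)).
apply: converse aE bE; split=> //.
- by rewrite normc_sqr /= expr0n/= addr0 sqr_sqrtr// ltW.
- by apply/eqP; rewrite eq_complex/= oppr0 !mulr0 subr0 add0r !divfK ?eqxx.
Qed.
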